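(* Let $N=\{1,\ldots,n\}$ and let $\mathcal{Q}(N)=\{(A,B)\in 2^N\times 2^N : A\cap B=\emptyset\}$, partially ordered by $(A,B)\sqsubseteq(C,D)$ iff $A\subseteq C$ and $B\supseteq D$. Then the M\''obius function $\mu$ of the poset $(\mathcal{Q}(N),\sqsubseteq)$ is given, for all $(A,A'),(B,B')\in\mathcal{Q}(N)$, by \[ \mu((A,A'),(B,B'))=\begin{cases}(-1)^{|B\setminus A|+|A'\setminus B'|}, & \text{if } (A,A')\sqsubseteq(B,B') \text{ and } A'\cap B=\emptyset,\\ 0, & \text{otherwise.}\end{cases} \]
   Context: For a finite poset $(X,\leq)$, the M\''obius function $\mu:X\times X\to\mathbb{Z}$ is defined inductively by $\mu(x,x)=1$, $\mu(x,y)=-\sum_{x\leq t<y}\mu(x,t)$ if $x<y$, and $\mu(x,y)=0$ otherwise. *)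

(* Defs.v *)
From HB Require Import structures.
From mathcomp Require Import all_boot all_order all_algebra.

Set Implicit Arguments.
Unset Strict Implicit.
Unset Printing Implicit Defensive.

Import Order.TTheory GRing.Theory.

(* The recursion for mu(x, y) is on y, going down the order.  The argument k
   only bounds its depth: every descending chain from y has at most #|T|
   elements, so k = #|T| never runs out; mobiusxx, mobius_lt and mobius_nle
   below are the defining equations, without k. *)
Fixpoint mobius_rec {d : Order.disp_t} {T : finPOrderType d} (k : nat)
    (x y : T) : int :=
  if k is k'.+1 then
    if x == y then 1%R
    else if (x < y)%O then (- \sum_(t | (x <= t < y)%O) mobius_rec k' x t)%R
    else 0%R
  else 0%R.

Definition mobius {d : Order.disp_t} {T : finPOrderType d} (x y : T) : int :=
  mobius_rec #|T| x y.

Section MobiusTheory.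
Context {d : Order.disp_t} {T : finPOrderType d}.
Implicit Types x y t : T.

Let height y := #|[pred t | (t < y)%O]|.

Let height_lt t y : (t < y)%O -> height t < height y.
Proof.
move=> ty; apply: proper_card; apply/properP; split.
  by apply/subsetP => s; rewrite !inE => /lt_trans; apply.
by exists t; rewrite !inE ?ty // ltxx.
Qed.

Let height_card y : height y < #|T|.
Proof.
apply: proper_card; apply/properP; split; first exact/subsetP.
by exists y; rewrite !inE // ltxx.
Qed.

Lemma mobius_rec_depth k k' x y : height y < k -> height y < k' ->
  mobius_rec k x y = mobius_rec k' x y.
Proof.
elim: k k' y => [|k IHk] [|k'] y //= yk yk'.
case: eqP => // _; case: ifP => // _; congr (- _)%R.
apply: eq_bigr => t /andP[_ /height_lt ty].
by apply: IHk; apply: leq_trans ty _.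
Qed.

Lemma mobiusxx x : mobius x x = 1%R.
Proof.
rewrite /mobius; case: #|T| (height_card x) => [|k] // _.
by rewrite /= eqxx.
Qed.

Lemma mobius_lt x y : (x < y)%O ->
  mobius x y = (- \sum_(t | (x <= t < y)%O) mobius x t)%R.
Proof.
move=> xy; rewrite {1}/mobius; have := height_card y.
case cT: #|T| => [|k] //= yk; rewrite (lt_eqF xy) xy; congr (- _)%R.
apply: eq_bigr => t /andP[_ /height_lt ty].
by apply: mobius_rec_depth (height_card t); apply: leq_trans ty _.
Qed.

Lemma mobius_nle x y : ~~ (x <= y)%O -> mobius x y = 0%R.
Proof.
rewrite le_eqVlt negb_or => /andP[/negPf xNy /negPf xNlty].
by rewrite /mobius; case: #|T| => //= k; rewrite xNy xNlty.
Qed.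

End MobiusTheory.

(* Q(N), for the n-element set N = 'I_n. *)
Record disjoint_pair (n : nat) := DisjointPair {
  pair_sets :> {set 'I_n} * {set 'I_n};
  pair_setsP : pair_sets.1 :&: pair_sets.2 == set0
}.

HB.instance Definition _ n := [isSub for @pair_sets n].
HB.instance Definition _ n := [Finite of disjoint_pair n by <:].

Fact disjoint_pair_display : Order.disp_t.
Proof. exact: Order.Disp tt tt. Qed.

Section DisjointPairOrder.
Variable n : nat.
Implicit Types P Q : disjoint_pair n.

Definition disjoint_pair_le P Q := (P.1 \subset Q.1) && (Q.2 \subset P.2).

Fact disjoint_pair_le_refl : reflexive disjoint_pair_le.
Proof. by move=> P; rewrite /disjoint_pair_le !subxx. Qed.

Fact disjoint_pair_le_anti : antisymmetric disjoint_pair_le.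
Proof.
move=> P Q /andP[/andP[PQ1 QP2] /andP[QP1 PQ2]]; apply/val_inj.
case: P Q PQ1 QP2 QP1 PQ2 => [[A A'] AP] [[B B'] BP] /= *.
by congr (_, _); apply/eqP; rewrite eqEsubset; apply/andP.
Qed.

Fact disjoint_pair_le_trans : transitive disjoint_pair_le.
Proof.
move=> Q P R /andP[PQ1 QP2] /andP[QR1 RQ2]; apply/andP; split.
  exact: subset_trans PQ1 QR1.
exact: subset_trans RQ2 QP2.
Qed.

HB.instance Definition _ := Order.Le_isPOrder.Build disjoint_pair_display
  (disjoint_pair n) disjoint_pair_le_refl disjoint_pair_le_anti
  disjoint_pair_le_trans.

End DisjointPairOrder.

(* Main.v *)
Require Import Defs.
From mathcomp Require Import all_boot all_order all_algebra.

(** The function equal to the right-hand side satisfies the recursion that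
    characterizes [mobius].  Indeed a pair [(C, D)] of the interval from
    [(A, A')] to [(B, B')] contributes only if [C] avoids [A'], and then it is
    automatically disjoint since [D] is contained in [A'].  Hence the sum over
    the interval is the product of the alternating sums over the Boolean
    intervals from [A] to [B :\: A'] and from [B'] to [A']; one of these is
    zero unless [A = B :\: A'] and [A' = B'], that is, unless the two pairs
    coincide. *)

Set Implicit Arguments.
Unset Strict Implicit.
Unset Printing Implicit Defensive.

Import Order.TTheory GRing.Theory Num.Theory.
Local Open Scope ring_scope.

Lemma mobius_unique (d : Order.disp_t) (T : finPOrderType d) (x : T)
    (f : T -> int) :
  f x = 1 ->
  (forall y, ~~ (x <= y)%O -> f y = 0) ->
  (forall y, (x < y)%O -> \sum_(t | (x <= t <= y)%O) f t = 0) ->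
  forall y, mobius x y = f y.
Proof.
move=> fx f0 fsum y.
have [m] := ubnP #|[pred t | (t < y)%O]|; elim: m y => // m IHm y ym.
have [xy|/negPf xNy] := boolP (x <= y)%O; last first.
  by rewrite mobius_nle ?f0 ?xNy.
have [<-|xDy] := eqVneq x y; first by rewrite mobiusxx fx.
have ltxy : (x < y)%O by rewrite lt_neqAle xDy.
have /eqP := fsum y ltxy; rewrite (bigD1 y) ?xy ?lexx //= addr_eq0 => /eqP ->.
rewrite mobius_lt //; congr (- _); apply: eq_big => [t|t /andP[_ ty]].
  by rewrite -andbA [(t < y)%O]lt_neqAle [(t != y) && _]andbC.
apply: IHm; rewrite -ltnS; apply: leq_trans ym; rewrite ltnS.
apply: proper_card; apply/properP; split.
  by apply/subsetP => s; rewrite !inE => /lt_trans; apply.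
by exists t; rewrite !inE ?ty // ltxx.
Qed.

Lemma sum_sign_interval (T : finType) (A B : {set T}) : A != B ->
  \sum_(C : {set T} | (A \subset C) && (C \subset B)) (-1) ^+ #|C| = 0 :> int.
Proof.
move=> AB; have [sAB|sABN] := boolP (A \subset B); last first.
  rewrite big_pred0 // => C; apply/negP => /andP[AC CB].
  by rewrite (subset_trans AC CB) in sABN.
have /properP[_ [x Bx Ax]] : A \proper B by rewrite properEneq AB.
pose toggle (C : {set T}) := if x \in C then C :\ x else x |: C.
have toggleK : involutive toggle.
  move=> C; rewrite /toggle; case Cx: (x \in C); first by rewrite setD11 setD1K.
  by rewrite setU11 setU1K ?Cx.
have sign_toggle C : (-1) ^+ #|toggle C| = - (-1) ^+ #|C| :> int.
  rewrite /toggle; case: ifP => Cx.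
    by rewrite [in RHS](cardsD1 x C) Cx exprS mulN1r opprK.
  by rewrite cardsU1 Cx exprS mulN1r.
set S := LHS; suff SN : S = - S.
  by apply/eqP; rewrite -eqNr -SN.
rewrite /S [LHS](reindex_inj (inv_inj toggleK)) -sumrN /=; apply: eq_big => C.
  rewrite /toggle; case: ifP => Cx.
    by rewrite subsetD1 Ax andbT subDset (setUidPr _) ?sub1set.
  rewrite subUset sub1set Bx /=; congr (_ && _); apply/idP/idP => [sAC|].
    by rewrite -[C](setU1K (negbT Cx)) subsetD1 sAC.
  by move=> sAC; rewrite subsetU // sAC orbT.
by move=> _; exact: sign_toggle.
Qed.

Lemma disjoint_pair_leE n (P Q : disjoint_pair n) :
  (P <= Q)%O = (P.1 \subset Q.1) && (Q.2 \subset P.2).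
Proof. by []. Qed.

Theorem theorem2 (n : nat) (A A' B B' : {set 'I_n})
    (dA : A :&: A' == set0) (dB : B :&: B' == set0) :
  let P : disjoint_pair n := @DisjointPair n (A, A') dA in
  let Q : disjoint_pair n := @DisjointPair n (B, B') dB in
  mobius P Q =
    if (P <= Q)%O && (A' :&: B == set0)
    then ((-1) ^+ (#|B :\: A| + #|A' :\: B'|))%R
    else 0%R.
Proof.
move=> P Q.
pose f (t : disjoint_pair n) : int :=
  if (P <= t)%O && (A' :&: t.1 == set0)
  then (-1) ^+ (#|t.1 :\: A| + #|A' :\: t.2|) else 0.
rewrite (@mobius_unique _ _ P f) // => {B B' dB Q} [|y|[[B B'] dB]].
- by rewrite /f lexx setIC dA /= !setDv cards0.
- by rewrite /f => /negPf ->.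
set Q := DisjointPair _; rewrite lt_neqAle => /andP[PDQ].
rewrite disjoint_pair_leE /= => /andP[AB B'A'].
pose F (p : {set 'I_n} * {set 'I_n}) : int :=
  (-1) ^+ #|p.1| * (-1) ^+ #|p.2| * (-1) ^+ (#|A| + #|A'|).
pose I (p : {set 'I_n} * {set 'I_n}) :=
  ((A \subset p.1) && (p.1 \subset B :\: A')) &&
  ((B' \subset p.2) && (p.2 \subset A')).
transitivity (\sum_(p | I p) F p).
  rewrite (@reindex_omap _ _ _ _ _ (@pair_sets n) insub); last first.
    move=> [C D] /andP[/andP[_ CBA'] /andP[_ DA']].
    rewrite insubT //=.
    move: CBA'; rewrite subsetD => /andP[_ /(disjointWr DA')].
    by rewrite -setI_eq0.
  rewrite (bigID (fun t : disjoint_pair n => A' :&: t.1 == set0)) /=.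
  rewrite [X in _ + X]big1 ?addr0; last first.
    by move=> t /andP[_ /negPf tA']; rewrite /f tA' andbF.
  apply: eq_big => [t|t /andP[/andP[Pt tQ] tA']].
    rewrite !disjoint_pair_leE /I /= valK eqxx andbT subsetD -setI_eq0.
    by rewrite [A' :&: _]setIC -!andbA; do !bool_congr.
  rewrite /f Pt tA' /F /=.
  move: Pt; rewrite disjoint_pair_leE /= => /andP[At tA].
  rewrite -(cardsID A t.1) (setIidPr At) -(cardsID t.2 A') (setIidPr tA).
  rewrite -!exprD -signr_odd -[RHS]signr_odd !oddD.
  by congr (_ ^+ _); do 4!case: odd.
have -> : \sum_(p | I p) F p =
    (\sum_(C : {set 'I_n} | (A \subset C) && (C \subset B :\: A'))
       (-1) ^+ #|C|) *
    (\sum_(D : {set 'I_n} | (B' \subset D) && (D \subset A')) (-1) ^+ #|D|) *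
    (-1) ^+ (#|A| + #|A'|).
  rewrite big_distrlr /= pair_big big_distrl /=.
  by apply: eq_big => -[].
have [EA|?] := eqVneq A (B :\: A'); last by rewrite sum_sign_interval ?mul0r.
have [EB|?] := eqVneq B' A'; last first.
  by rewrite (@sum_sign_interval _ B') ?mulr0 ?mul0r.
case/eqP: PDQ; apply: val_inj => /=; rewrite EA EB; congr (_, _).
by apply/setDidPl; rewrite -EB -setI_eq0.
Qed.
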